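(* (i) If $f:X\to\mathbb R$ is zero almost everywhere with respect to $\mu$, then $f$ is $D_\mu$-integrable and $\int f\,d\mu=0$. (ii) If $f_1,f_2:X\to\mathbb R$ are $D_\mu$-integrable, then so is $f_1+f_2$, with $\int(f_1+f_2)\,d\mu=\int f_1\,d\mu+\int f_2\,d\mu$. (iii) If $c\in\mathbb R$ and $f:X\to\mathbb R$ is $D_\mu$-integrable, then so is $cf$, with $\int cf\,d\mu=c\int f\,d\mu$. (iv) If $f:X\to\mathbb R$ with $f\ge0$ is $D_\mu$-integrable, then $\int f\,d\mu\ge0$.
   Context: $X$ is a compact metric space with metric $d$, $O_r(x)$ is the open ball of radius $r$ about $x$, and $\mu$ is a normalised Borel measure on $X$ (i.e. $\mu(X)=1$). Let $\mathcal B$ be a basis of open subsets of $X$ containing $\emptyset$ and closed under finite intersections (including the empty intersection, so $X\in\mathcal B$), and put $\mathbf C_{\mathcal B}=\{A_1\cap A_2^c: A_1,A_2\in\mathcal B\}$; its elements are called crescents. $\mathbf C_{\mathcal B}$ is partitionable if it is closed under finite intersections and, for all $C,C_0\in\mathbf C_{\mathcal B}$, the set $C\setminus C_0$ is a finite union of pairwise disjoint elements of $\mathbf C_{\mathcal B}$. Throughout, $\mathcal B$ is fixed with $\mathbf C_{\mathcal B}$ partitionable. A partition of $X$ is a finite set of pairwise disjoint non-empty crescents in $\mathbf C_{\mathcal B}$ with union $X$. A gauge on $X$ is a function $\gamma:X\to\mathbb R$ with $\gamma(x)>0$ for all $x$. A tagged partition of $X$ is a finite set $\dot P=\{(R_i,t_i):1\le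 i\le n\}$ where $\{R_i\}$ is a partition of $X$ and $t_i\in\overline{R_i}$; it is $\gamma$-fine, written $\dot P\prec\gamma$, if $\overline{R_i}\subset O_{\gamma(t_i)}(t_i)$ for all $i$. Put $\int f\,d\mu_{\dot P,\gamma}=\sum_i f(t_i)\mu(R_i)$. A function $f:X\to\mathbb R$ is $D_\mu$-integrable with $D_\mu$-integral $\int f\,d\mu=r\in\mathbb R$ if for every $\epsilon>0$ there is a gauge $\gamma$ on $X$ such that $|\int f\,d\mu_{\dot P,\gamma}-r|<\epsilon$ for every tagged partition $\dot P\prec\gamma$ of $X$. All integrals in the claim are $D_\mu$-integrals. *)

(* Defs.v *)
From HB Require Import structures.
From mathcomp Require Import all_boot all_order all_algebra.
From mathcomp Require Import all_classical all_reals all_analysis.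

Set Implicit Arguments.
Unset Strict Implicit.
Unset Printing Implicit Defensive.

Import Order.TTheory GRing.Theory Num.Theory.

Local Open Scope classical_set_scope.
Local Open Scope ring_scope.

(* MathComp-Analysis only puts sigma-algebras on pointed types.  The chosen
   point plays no role below, and a space carrying a measure of total mass 1
   is nonempty anyway. *)
#[short(type="pointedMetricType")]
HB.structure Definition PointedMetric (K : numDomainType) :=
  { T of Metric K T & isPointed T }.

Notation borel T := (g_sigma_algebraType (@open T)).

Section crescents.
Context {X : topologicalType}.

(* [fin_bigcap_closed] includes the empty intersection, hence [B setT]. *)
Definition bottomed_meet_basis (B : set (set X)) :=
  [/\ basis B, B set0 & fin_bigcap_closed B].

Definition crescents (B : set (set X)) : set (set X) :=
  [set A1 `&` ~` A2 | A1 in B & A2 in B].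

Definition partitionable (C : set (set X)) :=
  fin_bigcap_closed C /\ semi_setD_closed C.

(* The finite set {R_i} is given by its indexing; nonemptiness and
   disjointness make the cells pairwise distinct. *)
Definition crescent_partition (B : set (set X)) n (P : 'I_n -> set X) :=
  [/\ forall i, crescents B (P i),
      forall i, P i !=set0,
      trivIset [set: 'I_n] P &
      \bigcup_(i in [set: 'I_n]) P i = [set: X]].

Definition tagged_partition (B : set (set X)) n
    (P : 'I_n -> set X) (t : 'I_n -> X) :=
  crescent_partition B P /\ forall i, closure (P i) (t i).

End crescents.

Section D_integral.
Context {R : realType} {X : pointedMetricType R}.

Definition gauge (gamma : X -> R) := forall x, 0 < gamma x.

Definition gauge_fine (gamma : X -> R) n
    (P : 'I_n -> set X) (t : 'I_n -> X) :=
  forall i, closure (P i) `<=` [set y | mdist (t i) y < gamma (t i)].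

Variables (B : set (set X)) (mu : probability (borel X) R).

Definition tagged_sum (f : X -> R) n
    (P : 'I_n -> set X) (t : 'I_n -> X) : R :=
  \sum_(i < n) f (t i) * fine (mu (P i)).

Definition has_D_integral (f : X -> R) (r : R) :=
  forall eps : R, 0 < eps -> exists2 gamma : X -> R, gauge gamma &
    forall n (P : 'I_n -> set X) (t : 'I_n -> X),
      tagged_partition B P t -> gauge_fine gamma P t ->
      `|tagged_sum f P t - r| < eps.

Definition D_integrable (f : X -> R) := exists r, has_D_integral f r.

(* On a compact X every gauge admits a fine tagged partition, so the integral
   is unique; the default 0 is only taken when f is not integrable. *)
Definition D_integral (f : X -> R) : R := xget 0 (has_D_integral f).

End D_integral.

(* Main.v *)
(* The delicate points are uniqueness of the integral and part (i).

   Uniqueness rests on a Cousin lemma: every gauge has a fine tagged partition.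
   Otherwise, splitting X again and again into finitely many crescents of ever
   smaller diameter produces a decreasing sequence of nonempty crescents none
   of which has a fine tagged partition.  By compactness their closures share a
   point p, and a crescent of the sequence whose diameter is small compared to
   gamma(p) is a fine one-element partition of itself with tag p.

   For (i), Borel probability measures on metric spaces are outer regular, so
   the null set {f <> 0} is contained in open sets U_k with
   mu(U_k) < eps / (2^(k+1) (k+1)).  A gauge whose balls around the points with
   k <= |f| < k + 1 stay inside U_k makes every tagged sum smaller than
   eps (1/2 + 1/4 + ...). *)
Require Import Defs.
From HB Require Import structures.
From mathcomp Require Import all_boot all_order all_algebra.
From mathcomp Require Import all_classical all_reals all_analysis.
From mathcomp Require Import lra.

Set Implicit Arguments.
Unset Strict Implicit.
Unset Printing Implicit Defensive.

Import Order.TTheory GRing.Theory Num.Theory.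

Local Open Scope classical_set_scope.
Local Open Scope ring_scope.

(** * Crescents and disjointification *)

Section crescent_theory.
Context {X : topologicalType} (B : set (set X)).
Hypothesis basisB : bottomed_meet_basis B.
Hypothesis partB : partitionable (crescents B).

Lemma crescent_setD (A1 A2 : set X) : B A1 -> B A2 -> crescents B (A1 `\` A2).
Proof. by move=> BA1 BA2; exists A1 => //; exists A2. Qed.

Lemma crescent_basis (A : set X) : B A -> crescents B A.
Proof.
by move=> BA; rewrite -[A]setD0; apply: crescent_setD => //; case: basisB.
Qed.

Lemma crescentT : crescents B setT.
Proof.
apply: crescent_basis; case: basisB => _ _ /(_ nat set0 (fun=> setT)).
by rewrite bigcap_set0; apply.
Qed.

Lemma crescentI : setI_closed (crescents B).
Proof.
move=> C D cC cD; rewrite -bigcap2inE.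
by case: partB => + _; apply; [exact: finite_II | move=> [|[|i]]].
Qed.

(** Removing a finite union amounts to intersecting the differences [F n \ F k], each of them a
    crescent. *)
Lemma crescent_seqDU (F : nat -> set X) n :
  (forall i, B (F i)) -> crescents B (seqDU F n).
Proof.
move=> BF; suff D m : crescents B (F n `\` \big[setU/set0]_(k < m) F k).
  exact: D.
elim: m => [|m IHm].
  by rewrite big_ord0 setD0; exact: crescent_basis.
rewrite big_ord_recr/= setDUr; apply: crescentI => //.
exact: crescent_setD.
Qed.

End crescent_theory.

(** * Cousin's lemma: existence of fine tagged partitions *)

Section cousin.
Context {R : realType} {X : pointedMetricType R} (B : set (set X)).
Hypotheses (cptX : compact [set: X]) (basisB : bottomed_meet_basis B).
Hypothesis partB : partitionable (crescents B).

Lemma finite_small_cover (e : R) : 0 < e ->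
  exists (n : nat) (F : nat -> set X),
    [/\ forall i, B (F i), \bigcup_(i < n) F i = setT &
        forall i x y, F i x -> F i y -> mdist x y < e].
Proof.
move=> e0; have [[oB nB] B0 _] := basisB.
have e20 : 0 < e / 2 by rewrite divr_gt0.
have /choice[A AP] : forall x, exists A : set X,
    [/\ B A, A x & A `<=` [set y | mdist x y < e / 2]].
  move=> x; have [A [/= BA Ax] sA] := nB x _ (nbhsx_ballx x _ e20).
  by exists A; split => //; rewrite -ballEmdist.
have cpt : cover_compact [set: X] by rewrite -compact_cover.
have oA x : setT x -> open (A x) by move=> _; apply: oB; case: (AP x).
have cA : [set: X] `<=` cover setT A by move=> x _; exists x; case: (AP x).
have [K _ Kcov] := cpt X setT A oA cA; pose s : seq X := finmap.enum_fset K.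
(* Padding with the empty set, a member of [B], gives a sequence on all of [nat], to which [seqDU]
   applies. *)
exists (size s), (fun i => if (i < size s)%N then A (nth point s i) else set0).
split=> [i||i x y].
- by case: ifP => // _; case: (AP (nth point s i)).
- apply/seteqP; split => // x _; have [z zs Azx] := Kcov x I.
  exists (index z s); first by rewrite /= index_mem.
  by rewrite index_mem zs nth_index.
- case: ifP => // _; have [_ _ sA] := AP (nth point s i).
  move=> /sA/= xe /sA/= ye; rewrite [ltRHS]splitr.
  apply: le_lt_trans (metric_triangle x (nth point s i) y) _.
  by rewrite (metric_sym x) ltrD.
Qed.

Lemma crescent_split (C : set X) (e : R) : crescents B C -> 0 < e ->
  exists (n : nat) (D : 'I_n -> set X),
    [/\ forall i, crescents B (D i), trivIset setT D, \bigcup_i D i = C &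
        forall i x y, D i x -> D i y -> mdist x y < e].
Proof.
move=> cC /finite_small_cover[n [F [BF FT Fe]]].
exists n, (fun i => C `&` seqDU F i); split => [i|i j _ _||i x y].
- by apply: crescentI => //; exact: crescent_seqDU.
- move=> [x [[_ xi] [_ xj]]]; apply: ord_inj.
  by apply: (@trivIset_seqDU _ F) => //; exists x.
- rewrite -setI_bigcupr -[RHS]setIT; congr (_ `&` _).
  rewrite -FT (bigcup_mkord _ F) bigsetU_seqDU -bigcup_mkord.
  apply/seteqP; split=> x [i ilt xi]; first by exists i => //=.
  by exists (Ordinal ilt).
- by move=> [_ xi] [_ yi]; exact: Fe (subset_seqDU xi) (subset_seqDU yi).
Qed.

(* Arbitrary finite index types make these families closed under disjoint
   unions without any renumbering. *)
Definition finely_tagged (gamma : X -> R) (C : set X) :=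
  exists (I : finType) (P : I -> set X) (t : I -> X),
    [/\ forall i, crescents B (P i) /\ P i !=set0,
        trivIset setT P, \bigcup_i P i = C &
        forall i, closure (P i) (t i) /\
          closure (P i) `<=` [set y | mdist (t i) y < gamma (t i)]].

(** The empty family works, so a crescent that is not finely tagged has a point. *)
Lemma finely_tagged0 gamma : finely_tagged gamma set0.
Proof.
exists void, (of_void _), (of_void _); split; try by case.
by apply/seteqP; split => // x [].
Qed.

Lemma finely_tagged1 gamma (C : set X) x : crescents B C -> closure C x ->
  closure C `<=` [set y | mdist x y < gamma x] -> finely_tagged gamma C.
Proof.
move=> cC Cx Cg; exists unit, (fun=> C), (fun=> x); split => //.
- by move=> _; split => //; have [z []] := Cx setT filterT; exists z.
- by move=> [] [].
- by apply/seteqP; split => [y [] //|y Cy]; exists tt.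
Qed.

Lemma finely_tagged_bigcup gamma (J : finType) (C : J -> set X) :
  trivIset setT C -> (forall j, finely_tagged gamma (C j)) ->
  finely_tagged gamma (\bigcup_j C j).
Proof.
move=> tC ftC; have [I {}ftC] := all_sig (fun j => cid (ftC j)).
have [P {}ftC] := all_sig (fun j => cid (ftC j)).
have [t h] := all_sig (fun j => cid (ftC j)).
exists {j : J & I j}, (fun k => P (tag k) (tagged k)),
  (fun k => t (tag k) (tagged k)); split.
- by move=> [j i]/=; have [/(_ i)] := h j.
- move=> [j i] [j' i'] _ _ /= [x [xi xi']].
  have sub k l : P k l `<=` C k.
    by have [_ _ <- _] := h k; exact: bigcup_sup.
  (* Cells that meet force the blocks [C j] and [C j'] containing them to meet. *)
  have jj' : j = j'.
    by apply: tC => //; exists x; split; [exact: sub xi|exact: sub xi'].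
  subst j'; have [_ tP _ _] := h j.
  by congr existT; apply: tP => //; exists x.
- apply/seteqP; split=> x.
  + move=> [[j i] _ /= xi]; exists j => //.
    by have [_ _ <- _] := h j; exists i.
  + move=> [j _]; have [_ _ <- _] := h j.
    by move=> [i _ xi]; exists (existT _ j i).
- by move=> [j i]/=; have [_ _ _ /(_ i)] := h j.
Qed.

(** If all the small pieces of [C] were finely tagged, gluing their families would tag [C]. *)
Lemma not_finely_tagged_shrink gamma (C : set X) (e : R) :
  crescents B C -> ~ finely_tagged gamma C -> 0 < e ->
  exists D : set X, [/\ crescents B D, ~ finely_tagged gamma D, D `<=` C &
    forall x y, D x -> D y -> mdist x y < e].
Proof.
move=> cC nC /(crescent_split cC)[n [D [cD tD DC De]]].
have [i nDi] : exists i, ~ finely_tagged gamma (D i).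
  apply/existsNP => fD; apply: nC; rewrite -DC.
  exact: finely_tagged_bigcup.
exists (D i); split => //; last exact: De.
by rewrite -DC; exact: bigcup_sup.
Qed.

Lemma finely_taggedT gamma : gauge gamma -> finely_tagged gamma setT.
Proof.
move=> g0; apply: contrapT => nT.
(* Bundling the invariant into a subtype lets choice give a step function that can be iterated. *)
pose S := {C : set X | crescents B C /\ ~ finely_tagged gamma C}.
have /choice[g gP] : forall p : nat * S, exists D : S,
    sval D `<=` sval p.2 /\
    forall x y, sval D x -> sval D y -> mdist x y < p.1.+1%:R^-1.
  move=> [n [C [cC nC]]]/=.
  have [|D [cD nD DC De]] := not_finely_tagged_shrink (e := n.+1%:R^-1) cC nC.
    by rewrite invr_gt0.
  by exists (exist _ D (conj cD nD)).
pose C n : S := iteri n (fun n D => g (n, D))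
  (exist _ setT (conj (crescentT basisB) nT)).
have Cni : {homo (fun n => sval (C n)) : m n / (m <= n)%N >-> n `<=` m}.
  apply: homo_leq => [D//|D E F ED FE x /FE /ED//|n].
  by have [] := gP (n, C n).
have /choice[u uC] : forall n, exists x, sval (C n) x.
  move=> n; apply/set0P/eqP => C0.
  by case: (svalP (C n)) => _; rewrite C0; apply; exact: finely_tagged0.
(* [p] is a cluster point of points [u n] of [C n]; as the [C n] decrease, it lies in the closure of
   each. *)
have [p [_ pu]] := cptX (F := u @ \oo) _ filterT.
have pC n : closure (sval (C n)) p.
  move=> V pV; apply: pu pV; exists n => // m /= nm.
  exact: Cni nm _ (uC m).
(* Both [p] and [y] are only in the closure of [C n.+1], so they are approximated by [x] and [z] in
   it; the path from [p] through [x] and [z] to [y] has three legs. The step from [C n] to [C n.+1]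
   is the one that brings distances below [n.+1%:R^-1]. *)
have g30 : 0 < gamma p / 3 by rewrite divr_gt0.
have [n _ /(_ n (leqnn n))/= ng] := near_infty_natSinv_lt (PosNum g30).
have [cC nC] := svalP (C n.+1); apply: nC.
apply: (@finely_tagged1 _ _ p) => // y Cy /=.
have [x []] := pC n.+1 _ (nbhsx_ballx p _ g30).
have [z []] := Cy _ (nbhsx_ballx y _ g30).
rewrite !ballEmdist/= => Cz yz Cx px.
have xz : mdist x z < gamma p / 3.
  apply: lt_trans ng.
  by have [_] := gP (n, C n); exact.
have := metric_triangle p x y; have := metric_triangle x z y.
rewrite (metric_sym z); lra.
Qed.

Lemma cousin gamma : gauge gamma -> exists n (P : 'I_n -> set X) t,
  tagged_partition B P t /\ gauge_fine gamma P t.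
Proof.
move=> /finely_taggedT[I [P [t [cP tP PT ht]]]].
exists #|I|, (P \o enum_val), (t \o enum_val).
split; [split; [split|]|] => [i|i|||i|i] /=.
- by case: (cP (enum_val i)).
- by case: (cP (enum_val i)).
- by move=> i j _ _ ij; exact/enum_val_inj/tP.
- apply/seteqP; split => // x _.
  have : (\bigcup_i P i) x by rewrite PT.
  by move=> [i _ Pix]; exists (enum_rank i) => //=; rewrite enum_rankK.
- by case: (ht (enum_val i)).
- by case: (ht (enum_val i)).
Qed.

End cousin.

(** * Regularity of Borel probability measures on metric spaces *)

Section regularity.
Context {R : realType} {X : pointedMetricType R} (mu : probability (borel X) R).
Implicit Types A F U : set X.

Lemma borel_open U : open U -> measurable (U : set (borel X)).
Proof. by move=> oU; exact: sub_sigma_algebra. Qed.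

Lemma borel_closed F : closed F -> measurable (F : set (borel X)).
Proof.
by rewrite -openC => /borel_open/measurableC; rewrite setCK.
Qed.

Lemma nonincreasing_measure_lt (E : (set (borel X))^nat) (e : \bar R) :
  (forall n, measurable (E n)) -> nonincreasing_seq E ->
  (mu (\bigcap_n E n) < e)%E -> exists n, (mu (E n) < e)%E.
Proof.
move=> mE niE lte.
have cE : mu \o E @ \oo --> mu (\bigcap_n E n).
  apply: nonincreasing_cvg_mu => //; last exact: bigcapT_measurable.
  by rewrite (le_lt_trans (probability_le1 mu (mE 0%N))) ?ltry.
have [n _ /(_ n (leqnn n))] := cE _ (open_ereal_lt' lte).
by exists n.
Qed.

(** Approximating from inside and outside at once makes the property stable under complements. *)
Definition regular A := forall e : R, 0 < e -> exists F U,
  [/\ closed F, open U, F `<=` A, A `<=` U & (mu (U `\` F) < e%:E)%E].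

Lemma regularC A : regular A -> regular (~` A).
Proof.
move=> rA e /rA[F [U [cF oU FA AU lte]]].
exists (~` U), (~` F); split; [exact: open_closedC|exact: closed_openC| | |].
- exact: subsetC.
- exact: subsetC.
- by rewrite setDE setCK setIC -setDE.
Qed.

(** An open set is the increasing union of the closed sets of points at distance at least
    [n.+1%:R^-1] from its complement; continuity from above applies to what they leave out. *)
Lemma regular_open A : open A -> regular A.
Proof.
move=> oA e e0.
pose F n := [set x : X | forall y, ~ A y -> n.+1%:R^-1 <= mdist x y].
have cF n : closed (F n).
  move=> x Fx y nAy; apply/ler_addgt0Pr => d d0.
  have [z [/(_ y nAy) Fz]] := Fx _ (nbhsx_ballx x _ d0).
  rewrite ballEmdist/= => xz.
  have := metric_triangle z x y; rewrite (metric_sym z x) => zy.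
  by rewrite (le_trans Fz)// (le_trans zy)// addrC lerD2l ltW.
have FA n : F n `<=` A.
  move=> x Fx; apply: contrapT => /Fx; rewrite mdistxx.
  by rewrite leNgt invr_gt0 ltr0n.
have [|||n lte] := @nonincreasing_measure_lt (fun n => A `\` F n) e%:E.
- move=> n; apply: measurableD; first exact: borel_open.
  exact: borel_closed.
- move=> m n mn; apply/subsetPset; apply: setDS => x Fx y /Fx.
  by apply: le_trans; rewrite lef_pV2 ?posrE ?ler_nat ?ltr0n.
- rewrite (_ : \bigcap_n _ = set0) ?measure0 ?lte_fin//.
  apply/seteqP; split => // x xF; have [Ax _] := xF 0%N I.
  have [d /= d0 xdA] : nbhs_ball x A.
    by rewrite nbhs_ballE; exact: open_nbhs_nbhs.
  have [n _ /(_ n (leqnn n))/= nd] := near_infty_natSinv_lt (PosNum d0).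
  have [_] := xF n I; apply => y nAy; rewrite leNgt; apply/negP => xy.
  by apply/nAy/xdA; rewrite ballEmdist /= (lt_trans xy).
exists (F n), A; split => //.
Qed.

(** Only finite unions of the [F k] are sure to be closed, so the inner union is cut off at some
    [n], found by continuity from above. The limit set lies in the union of the [U k \ F k], of
    measure at most [e / 2]; the halving restores strictness. *)
Lemma regular_bigcup (A : (set X)^nat) :
  (forall n, regular (A n)) -> regular (\bigcup_n A n).
Proof.
move=> rA e e0; have e20 : 0 < e / 2 by rewrite divr_gt0.
have ek0 k : 0 < e / 2 / (2 ^ k.+1)%:R by rewrite divr_gt0// ltr0n expn_gt0.
have /choice[F /choice[U FU]] := fun k => rA k _ (ek0 k).
have mF k : measurable (F k : set (borel X)).
  by apply: borel_closed; case: (FU k).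
have mU k : measurable (U k : set (borel X)).
  by apply: borel_open; case: (FU k).
have oU : open (\bigcup_k U k) by apply: bigcup_open => k _; case: (FU k).
have [|||n lte] := @nonincreasing_measure_lt
    (fun n => \bigcup_k U k `\` \bigcup_(k < n) F k) e%:E.
- move=> n; apply: measurableD; first exact: borel_open.
  exact: bigcup_measurable.
- move=> m n mn; apply/subsetPset; apply: setDS.
  by apply: bigcup_subset => k /= /leq_trans; apply.
- apply: (@le_lt_trans _ _ (e / 2)%:E); last first.
    by rewrite lte_fin ltr_pdivrMr// ltr_pMr// ltr1n.
  apply: le_trans (epsilon_trick0 xpredT (ltW e20)).
  apply: (@le_trans _ _ (\sum_(k <oo) mu (U k `\` F k))%E); last first.
    by apply: lee_nneseries => // k _; apply: ltW; case: (FU k).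
  apply: measure_sigma_subadditive => [k||].
  + exact: measurableD.
  + apply: bigcapT_measurable => n; apply: measurableD.
      exact: borel_open.
    exact: bigcup_measurable.
  + move=> x xUF; have [[k _ Ukx] _] := xUF 0%N I.
    exists k => //; split => // Fkx.
    by have [_] := xUF k.+1 I; apply; exists k => /=.
exists (\bigcup_(k < n) F k), (\bigcup_k U k); split => //.
- by apply: closed_bigcup => // k _; case: (FU k).
- by move=> x [k _ Fx]; exists k => //; have [_ _ + _ _] := FU k; apply.
- by move=> x [k _ Ax]; exists k => //; have [_ _ _ + _] := FU k; apply.
Qed.

Lemma borel_regular A : measurable (A : set (borel X)) -> regular A.
Proof.
move: A; apply: smallest_sub; last exact: regular_open.
split.
- move=> e e0; exists set0, set0; split => //; first exact: closed0.
    exact: open0.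
  by rewrite setD0 measure0 lte_fin.
- by move=> A rA; rewrite setTD; exact: regularC.
- exact: regular_bigcup.
Qed.

(** Regularity is applied to a measurable null set [N] containing [A]; the closed set inside [N] is
    null, so [U] has the measure of [U \ F]. *)
Lemma null_outer_open A (e : R) : mu.-negligible (A : set (borel X)) -> 0 < e ->
  exists U, [/\ open U, A `<=` U & fine (mu U) < e].
Proof.
move=> [N [mN N0 AN]] e0.
have [F [U [cF oU FN NU lte]]] := borel_regular mN e0.
exists U; split => //; first exact: subset_trans AN NU.
have mF := borel_closed cF; have mU := borel_open oU.
have F0 : mu F = 0%E by apply: subset_measure0 mF mN FN N0.
suff muUE : mu U = mu (U `\` F).
  by rewrite -lte_fin fineK ?muUE// fin_num_measure//; exact: measurableD.
rewrite measureD//; last by rewrite (le_lt_trans (probability_le1 mu mU)) ?ltry.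
have UF0 := subset_measure0 (measurableI _ _ mU mF) mF (@subIsetr _ U F) F0.
by rewrite UF0 sube0.
Qed.

End regularity.

(** * Uniqueness and properties of the integral *)

Section D_integral_theory.
Context {R : realType} {X : pointedMetricType R} (B : set (set X)).
Hypotheses (cptX : compact [set: X]) (basisB : bottomed_meet_basis B).
Hypothesis partB : partitionable (crescents B).
Variable mu : probability (borel X) R.
Implicit Types f : X -> R.

Lemma gauge_min (g1 g2 : X -> R) :
  gauge g1 -> gauge g2 -> gauge (fun x => Num.min (g1 x) (g2 x)).
Proof. by move=> g10 g20 x; rewrite lt_min g10 g20. Qed.

Lemma gauge_fineW (g h : X -> R) n (P : 'I_n -> set X) t :
  (forall x, g x <= h x) -> gauge_fine g P t -> gauge_fine h P t.
Proof. by move=> gh gf i y /gf/= /lt_le_trans; exact. Qed.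

Lemma has_D_integral_tagged f1 f2 (r1 r2 e : R) : 0 < e ->
  has_D_integral B mu f1 r1 -> has_D_integral B mu f2 r2 ->
  exists2 g, gauge g & forall n (P : 'I_n -> set X) t,
    tagged_partition B P t -> gauge_fine g P t ->
    `|tagged_sum mu f1 P t - r1| < e /\ `|tagged_sum mu f2 P t - r2| < e.
Proof.
move=> e0 /(_ e e0)[g1 g10 h1] /(_ e e0)[g2 g20 h2].
exists (fun x => Num.min (g1 x) (g2 x)); first exact: gauge_min.
move=> n P t tP fP; split.
- by apply: h1 => //; apply: gauge_fineW fP => x; rewrite ge_min lexx.
- by apply: h2 => //; apply: gauge_fineW fP => x; rewrite ge_min lexx orbT.
Qed.

(** One tagged sum, provided by [cousin] for a common gauge, is within [e / 2] of both values. *)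
Lemma has_D_integral_unique f (r1 r2 : R) :
  has_D_integral B mu f r1 -> has_D_integral B mu f r2 -> r1 = r2.
Proof.
move=> h1 h2; apply/eqP; rewrite -subr_eq0 -normr_le0.
apply/ler_addgt0Pl => e e0.
have e20 : 0 < e / 2 by rewrite divr_gt0.
have [g g0 hg] := has_D_integral_tagged e20 h1 h2.
have [n [P [t [tP fP]]]] := cousin cptX basisB partB g0.
have [lt1 lt2] := hg _ _ _ tP fP.
rewrite addr0 (splitr e) ltW//.
rewrite (_ : r1 - r2 = (tagged_sum mu f P t - r2) - (tagged_sum mu f P t - r1)).
  by rewrite (le_lt_trans (ler_normB _ _))// addrC ltrD.
lra.
Qed.

Lemma has_D_integralE f (r : R) :
  has_D_integral B mu f r -> D_integral B mu f = r.
Proof.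
move=> fr; apply: xget_unique => // s fs; exact: has_D_integral_unique fs fr.
Qed.

Lemma D_integrableP f :
  D_integrable B mu f -> has_D_integral B mu f (D_integral B mu f).
Proof. by move=> [r fr]; rewrite (has_D_integralE fr). Qed.

Lemma has_D_integralD f1 f2 (r1 r2 : R) :
  has_D_integral B mu f1 r1 -> has_D_integral B mu f2 r2 ->
  has_D_integral B mu (fun x => f1 x + f2 x) (r1 + r2).
Proof.
move=> h1 h2 e e0; have e20 : 0 < e / 2 by rewrite divr_gt0.
have [g g0 hg] := has_D_integral_tagged e20 h1 h2.
exists g => // n P t tP fP; have [lt1 lt2] := hg _ _ _ tP fP.
have -> : tagged_sum mu (fun x => f1 x + f2 x) P t =
    tagged_sum mu f1 P t + tagged_sum mu f2 P t.
  by rewrite -big_split; apply: eq_bigr => i _; rewrite mulrDl.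
by rewrite opprD addrACA (splitr e) (le_lt_trans (ler_normD _ _))// ltrD.
Qed.

Lemma has_D_integralZ (c : R) f (r : R) : has_D_integral B mu f r ->
  has_D_integral B mu (fun x => c * f x) (c * r).
Proof.
(* Adding 1 keeps the divisor positive when [c = 0]. *)
move=> fr e e0; have c0 : 0 < `|c| + 1 by rewrite ltr_wpDl.
have [g g0 hg] := fr _ (divr_gt0 e0 c0).
exists g => // n P t tP fP; have := hg _ _ _ tP fP.
have -> : tagged_sum mu (fun x => c * f x) P t = c * tagged_sum mu f P t.
  by rewrite mulr_sumr; apply: eq_bigr => i _; rewrite mulrA.
rewrite -mulrBr normrM ltr_pdivlMr// mulrC => /(le_lt_trans _); apply.
by rewrite ler_wpM2r// lerDl.
Qed.

(** By [cousin] some nonnegative tagged sum is within [e] of [r], whence [- e < r]. *)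
Lemma has_D_integral_ge0 f (r : R) : (forall x, 0 <= f x) ->
  has_D_integral B mu f r -> 0 <= r.
Proof.
move=> f0 fr; apply/ler_addgt0Pl => e e0; have [g g0 hg] := fr _ e0.
have [n [P [t [tP fP]]]] := cousin cptX basisB partB g0.
have := hg _ _ _ tP fP; have : 0 <= tagged_sum mu f P t.
  by apply: sumr_ge0 => i _; rewrite mulr_ge0// fine_ge0.
rewrite ltr_norml => s0 /andP[_]; lra.
Qed.

Lemma crescent_measurable (C : set X) :
  crescents B C -> measurable (C : set (borel X)).
Proof.
have [[oB _] _ _] := basisB.
move=> [A1 /oB oA1 [A2 /oB oA2 <-]]; apply: measurableI.
  exact: borel_open.
by apply: measurableC; exact: borel_open.
Qed.

(** By disjointness the sum is the measure of a union of cells inside [U]. *)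
Lemma sum_measure_le n (P : 'I_n -> set X) (S : pred 'I_n) (U : set X) :
  crescent_partition B P -> open U -> (forall i, S i -> P i `<=` U) ->
  \sum_(i < n | S i) fine (mu (P i)) <= fine (mu U).
Proof.
move=> [cP _ tP _] oU PU.
have mP i : measurable (P i : set (borel X)) by exact: crescent_measurable.
have mS : measurable (\big[setU/set0]_(i < n | S i) P i : set (borel X)).
  exact: bigsetU_measurable.
have mU := borel_open oU.
rewrite -lee_fin fineK ?fin_num_measure// -sumEFin.
under eq_bigr do rewrite fineK ?fin_num_measure//.
rewrite -measure_bigsetU_ord//; apply: le_measure; rewrite ?inE//.
by elim/big_ind: _ => // C D CU DU; rewrite subUset.
Qed.

Lemma sum_halves_lt (K : nat) : \sum_(k < K) (2 ^ k.+1)%:R^-1 < 1 :> R.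
Proof.
suff -> : \sum_(k < K) (2 ^ k.+1)%:R^-1 = 1 - (2 ^ K)%:R^-1 :> R.
  by rewrite ltrBlDr ltrDl invr_gt0 ltr0n expn_gt0.
elim: K => [|K IHK]; first by rewrite big_ord0 expn0 invr1 subrr.
rewrite big_ord_recr/= IHK expnS natrM invfM.
have := @splitr R (2 ^ K)%:R^-1; lra.
Qed.

Lemma has_D_integral_ae0 f : {ae mu, forall x, f x = 0} ->
  has_D_integral B mu f 0.
Proof.
move=> f0 e e0.
(* The factor [k.+1] offsets the bound on [|f|] at level [k]; the powers of 2 make the levels
   summable. *)
have ek0 k : 0 < e / (2 ^ k.+1)%:R / k.+1%:R.
  by rewrite !divr_gt0// ltr0n expn_gt0.
have /choice[U UP] := fun k => null_outer_open f0 (ek0 k).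
pose lvl x := Num.trunc `|f x|.
have /choice[g gP] : forall x, exists d : R, 0 < d /\
    (f x != 0 -> [set y | mdist x y < d] `<=` U (lvl x)).
  (* Zeros of [f] contribute nothing as tags, so the gauge there is arbitrary. *)
  move=> x; have [fx0|fx0] := eqVneq (f x) 0; first by exists 1; split.
  have [oU NU _] := UP (lvl x).
  have [d /= d0 xdU] : nbhs_ball x (U (lvl x)).
    rewrite nbhs_ballE; apply: open_nbhs_nbhs; split => //; apply: NU.
    exact/eqP.
  by exists d; split => // _; rewrite -ballEmdist.
exists g => [x|n P t [cP tP] fP]; first by case: (gP x).
(* A strict bound on the levels of the finitely many tags. *)
rewrite subr0; pose K := (\max_(i < n) lvl (t i)).+1.
have ltK i : (lvl (t i) < K)%N by rewrite ltnS leq_bigmax.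
apply: (@le_lt_trans _ _
    (\sum_(i < n | f (t i) != 0) (lvl (t i)).+1%:R * fine (mu (P i)))).
  rewrite (le_trans (ler_norm_sum _ _ _))// [leRHS]big_mkcond/=.
  apply: ler_sum => i _; rewrite normrM (ger0_norm (fine_ge0 _))//.
  case: eqP => [->|_]/=; first by rewrite normr0 mul0r.
  by rewrite ler_wpM2r ?fine_ge0// ltW// truncnS_gt.
apply: (@le_lt_trans _ _ (\sum_(k < K) e / (2 ^ k.+1)%:R)); last first.
  by rewrite -mulr_sumr -[ltRHS]mulr1 ltr_pM2l// sum_halves_lt.
(* Terms are grouped by the level [k] of their tag; fineness puts all cells of a group inside
   [U k]. *)
rewrite (partition_big (fun i => Ordinal (ltK i)) xpredT)//=.
apply: ler_sum => k _.
have [oU _ /ltW] := UP k; rewrite ler_pdivlMr// mulrC.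
apply: le_trans.
rewrite (eq_bigr (fun i => k.+1%:R * fine (mu (P i)))); last first.
  by move=> i /andP[_ /eqP <-].
rewrite -mulr_sumr ler_wpM2l//; apply: sum_measure_le => //.
move=> i /andP[fti /eqP <-]/= x Pix.
by have [_ /(_ fti)] := gP (t i); apply; exact/fP/subset_closure.
Qed.

End D_integral_theory.

Theorem proposition4p5 (R : realType) (X : pointedMetricType R)
    (cptX : compact [set: X])
    (mu : probability (borel X) R)
    (B : set (set X)) (basisB : bottomed_meet_basis B)
    (partB : partitionable (crescents B)) :
  [/\ forall f : X -> R, {ae mu, forall x, f x = 0} ->
        D_integrable B mu f /\ D_integral B mu f = 0,
      forall f1 f2 : X -> R,
        D_integrable B mu f1 -> D_integrable B mu f2 ->
        D_integrable B mu (fun x => f1 x + f2 x) /\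
        D_integral B mu (fun x => f1 x + f2 x) =
          D_integral B mu f1 + D_integral B mu f2,
      forall (c : R) (f : X -> R), D_integrable B mu f ->
        D_integrable B mu (fun x => c * f x) /\
        D_integral B mu (fun x => c * f x) = c * D_integral B mu f &
      forall f : X -> R, (forall x, 0 <= f x) -> D_integrable B mu f ->
        0 <= D_integral B mu f].
Proof.
have intP := D_integrableP cptX basisB partB (mu := mu).
have intE := has_D_integralE cptX basisB partB (mu := mu).
split.
- move=> f /(has_D_integral_ae0 basisB) f0.
  by split; [exists 0|exact: intE].
- move=> f1 f2 /intP i1 /intP i2; have i12 := has_D_integralD i1 i2.
  by split; [eexists; exact: i12|exact: intE].
- move=> c f /intP fi; have cfi := has_D_integralZ c fi.
  by split; [eexists; exact: cfi|exact: intE].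
- by move=> f f0 /intP; exact: has_D_integral_ge0.
Qed.
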